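(* For $n\geq 1$ let $\mathrm{QOSet}_n$ be the set of quasiorders on $\{1,\dots,n+1\}$ and $\mathrm{QOSet}=\bigsqcup_{n\geq1}\mathrm{QOSet}_n$. For $Q\in\mathrm{QOSet}_n$, $Q'\in\mathrm{QOSet}_m$ and $1\leq i\leq n$ put $$Q\odot_i Q'=\gamma\bigl(\sigma^{i,m}(Q)\cup\sigma^{0,i}(Q')\bigr),$$ where $\gamma$ denotes transitive closure. Then $\mathrm{QOSet}$ with the partial compositions $\odot_i$ is an operad, and it is isomorphic to the operad $\mathrm{OP}(\odot)$ described in the context.
   Context: Operads: a (nonsymmetric, set) operad is a graded set $P=\bigsqcup_{n\geq1}P_n$ with maps $\circ_i:P_n\times P_m\to P_{n+m-1}$ ($1\leq i\leq n$) and a unit $\mathbf 1\in P_1$ such that for $p_1\in P_n,p_2\in P_m,p_3\in P_p$: $(p_1\circ_ip_2)\circ_{j+m-1}p_3=(p_1\circ_jp_3)\circ_ip_2$ for $1\leq i<j\leq n$; $(p_1\circ_ip_2)\circ_{i+j-1}p_3=p_1\circ_i(p_2\circ_jp_3)$ for $1\leq i\leq n$, $1\leq j\leq m$; $p_1\circ_i\mathbf 1=p_1=\mathbf 1\circ_1p_1$. Isomorphisms are arity-preserving bijections preserving unit and all partial compositions. A quasiorder is a reflexive and transitive relation. For $i\in\mathbb Z$, $n\geq1$ and a positive integer $x$, let $\sigma^{i,n}(x)=x$ if $x\leq i$ and $\sigma^{i,n}(x)=x+n-1$ otherwise; extend to pairs by $\sigma^{i,n}(x,y)=(\sigma^{i,n}(x),\sigma^{i,n}(y))$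 and to sets of pairs elementwise. The operad $\mathrm{OP}(\odot)$: let $\mathcal S_n$ be the set of all subsets of $\{(x,y):1\leq x,y\leq n+1,\ x\neq y\}$ and $\mathcal S=\bigcup_n\mathcal S_n$, a commutative monoid under $\cup$. For $R\in\mathcal S$ put $\gamma^{A}(R)=\gamma(R)\setminus\{(x,x):x\geq1\}$, and let $R\sim R'$ iff $\gamma^A(R)=\gamma^A(R')$; this is a congruence of $(\mathcal S,\cup)$ compatible with the maps $\sigma^{i,n}$. Write $[R]$ for the class of $R$. The elements of arity $n$ of $\mathrm{OP}(\odot)$ are the symbols $a^{(n)}_{[R]}$ with $R\in\mathcal S_n$, and the partial compositions are $$a^{(n)}_{[R]}\odot_i a^{(m)}_{[R']}=a^{(n+m-1)}_{[\sigma^{i,m}(R)\cup\sigma^{0,i}(R')]},\qquad 1\leq i\leq n,$$ with unit $a^{(1)}_{[\emptyset]}$. *)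

(* Defs.v *)
From Stdlib Require Import Relation_Operators.
From mathcomp Require Import all_boot.
From mathcomp Require Import mathcomp_extra boolp classical_sets functions.

Set Implicit Arguments.
Unset Strict Implicit.
Unset Printing Implicit Defensive.

Local Open Scope classical_set_scope.

(* A graded set P_1, P_2, ... is given by a family of subsets [op_set P n] of
   an ambient type (the value at n = 0 is never used); [op_comp P n m i] is
   the partial composition "o_i" from P_n x P_m, meaningful only on these
   subsets and for 1 <= i <= n. *)
Record operad_data := OperadData {
  op_car : Type;
  op_set : nat -> set op_car;
  op_comp : nat -> nat -> nat -> op_car -> op_car -> op_car;
  op_unit : op_car }.

Arguments op_set : clear implicits.
Arguments op_unit : clear implicits.

Record is_operad (P : operad_data) : Prop := IsOperad {
  op_unitP : op_set P 1 (op_unit P);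
  op_compP : forall n m i p q, 0 < m -> 1 <= i <= n ->
    op_set P n p -> op_set P m q ->
    op_set P (n + m - 1) (op_comp n m i p q);
  op_parallel : forall n1 n2 n3 i j p1 p2 p3, 0 < n2 -> 0 < n3 ->
    1 <= i -> i < j -> j <= n1 ->
    op_set P n1 p1 -> op_set P n2 p2 -> op_set P n3 p3 ->
    op_comp (n1 + n2 - 1) n3 (j + n2 - 1) (op_comp n1 n2 i p1 p2) p3 =
    op_comp (n1 + n3 - 1) n2 i (op_comp n1 n3 j p1 p3) p2;
  op_sequential : forall n1 n2 n3 i j p1 p2 p3, 0 < n3 ->
    1 <= i <= n1 -> 1 <= j <= n2 ->
    op_set P n1 p1 -> op_set P n2 p2 -> op_set P n3 p3 ->
    op_comp (n1 + n2 - 1) n3 (i + j - 1) (op_comp n1 n2 i p1 p2) p3 =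
    op_comp n1 (n2 + n3 - 1) i p1 (op_comp n2 n3 j p2 p3);
  op_unitr : forall n i p, 1 <= i <= n -> op_set P n p ->
    op_comp n 1 i p (op_unit P) = p;
  op_unitl : forall n p, 0 < n -> op_set P n p ->
    op_comp 1 n 1 (op_unit P) p = p }.

Definition operad_iso (P P' : operad_data) : Prop :=
  exists f : nat -> op_car P -> op_car P',
    [/\ forall n, 0 < n -> set_bij (op_set P n) (op_set P' n) (f n),
        f 1 (op_unit P) = op_unit P'
      & forall n m i p q, 0 < m -> 1 <= i <= n ->
          op_set P n p -> op_set P m q ->
          f (n + m - 1) (op_comp n m i p q) =
          op_comp n m i (f n p) (f m q)].

(* Relations on finite sets of positive integers, as sets of pairs. *)
Definition pairs := set (nat * nat).

Definition sigma (i n x : nat) : nat := if x <= i then x else x + n - 1.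

Definition sigma2 (i n : nat) (p : nat * nat) : nat * nat :=
  (sigma i n p.1, sigma i n p.2).

Definition tclosure (R : pairs) : pairs :=
  [set p | clos_trans nat (fun x y => R (x, y)) p.1 p.2].

Definition graft (m i : nat) (R R' : pairs) : pairs :=
  (sigma2 i m @` R) `|` (sigma2 0 i @` R').

Definition quasiorder_on (n : nat) (Q : pairs) : Prop :=
  [/\ forall x y, Q (x, y) -> (1 <= x <= n) /\ (1 <= y <= n),
      forall x, 1 <= x <= n -> Q (x, x)
    & forall x y z, Q (x, y) -> Q (y, z) -> Q (x, z)].

(* [e] is the candidate for the unit. *)
Definition QOSet (e : pairs) : operad_data :=
  {| op_car := pairs;
     op_set := fun n => [set Q | quasiorder_on n.+1 Q];
     op_comp := fun _ m i Q Q' => tclosure (graft m i Q Q');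
     op_unit := e |}.

Definition Sn (n : nat) : set pairs :=
  [set R | forall x y, R (x, y) ->
     [/\ 1 <= x <= n.+1, 1 <= y <= n.+1 & x <> y]].

Definition Sall : set pairs := [set R | exists2 n, 0 < n & Sn n R].

Definition tclosureA (R : pairs) : pairs :=
  tclosure R `\` [set p | p.1 = p.2].

Definition Sclass (R : pairs) : set pairs :=
  [set R' | Sall R' /\ tclosureA R = tclosureA R'].

(* The symbol a^(n)_[R] is the class [R], viewed in arity n.  The composition
   of two classes is the union of the classes obtained from all choices of
   representatives; these all coincide, see [op_comp_OP]. *)
Definition OP : operad_data :=
  {| op_car := set pairs;
     op_set := fun n => Sclass @` Sn n;
     op_comp := fun _ m i C C' =>
       \bigcup_(R in C) \bigcup_(R' in C') Sclass (graft m i R R');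
     op_unit := Sclass set0 |}.

Lemma sub_tclosure (R : pairs) : R `<=` tclosure R.
Proof. by case=> x y Rxy; apply: t_step. Qed.

Lemma tclosure_min (R R' : pairs) :
  R `<=` tclosure R' -> tclosure R `<=` tclosure R'.
Proof.
move=> sRR' [x y]; rewrite /tclosure /=; elim=> {x y} [x y /sRR' //|].
by move=> x y z _ xy _; apply: t_trans.
Qed.

Lemma tclosure_sigma2 (i n : nat) (R U : pairs) :
  sigma2 i n @` R `<=` U -> sigma2 i n @` tclosure R `<=` tclosure U.
Proof.
move=> sRU _ [[x y] + <-]; rewrite /tclosure /sigma2 /=.
elim=> {x y} [x y Rxy|x y z _ xy _]; last exact: t_trans.
by apply: t_step; apply: sRU; exists (x, y).
Qed.

Lemma sub_Sclass (R R1 : pairs) : Sall R1 ->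
  tclosureA R = tclosureA R1 -> R1 `<=` tclosure R.
Proof.
move=> [n _ SR1] e [x y] R1xy; have [_ _ nxy] := SR1 _ _ R1xy.
suff: tclosureA R (x, y) by case.
by rewrite e; split=> //; apply: sub_tclosure.
Qed.

Lemma sub_graft (m i : nat) (R R' R1 R1' : pairs) :
  Sall R1 -> tclosureA R = tclosureA R1 ->
  Sall R1' -> tclosureA R' = tclosureA R1' ->
  tclosure (graft m i R1 R1') `<=` tclosure (graft m i R R').
Proof.
move=> S1 e1 S1' e1'; apply: tclosure_min.
move=> x [[p R1p <-]|[p R1'p <-]].
- apply: (tclosure_sigma2 (R := R)); first exact: subsetUl.
  by exists p => //; apply: (sub_Sclass S1 e1).
- apply: (tclosure_sigma2 (R := R')); first exact: subsetUr.
  by exists p => //; apply: (sub_Sclass S1' e1').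
Qed.

Lemma op_comp_OP (n m i : nat) (R R' : pairs) :
  0 < n -> 0 < m -> Sn n R -> Sn m R' ->
  op_comp (o := OP) n m i (Sclass R) (Sclass R') = Sclass (graft m i R R').
Proof.
move=> n0 m0 SR SR'; have S1 : Sall R by exists n.
have S2 : Sall R' by exists m.
apply/seteqP; split=> [U [R1 [S3 e1]] [R1' [S4 e1']] [SU e]|U SU] /=.
  split=> //; rewrite -e /tclosureA; congr (_ `\` _).
  by apply/seteqP; split; apply: sub_graft.
by exists R => //; exists R'.
Qed.

(* Main.v *)
Require Import Defs.
From Stdlib Require Import Relation_Operators.
From mathcomp Require Import all_boot.
From mathcomp Require Import zify.
From mathcomp Require Import mathcomp_extra boolp classical_sets functions.

(** Since [tclosure] commutes with grafting, each operad axiom on quasiorders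
    reduces to an identity between the maps [sigma] on points.  Loops do not
    affect the nontrivial part [tclosureA] of a transitive closure, so a
    quasiorder corresponds to the class of the relation obtained by removing
    its loops; conversely, a relation without loops yields the quasiorder
    generated by it together with the diagonal. *)

Set Implicit Arguments.
Unset Strict Implicit.
Unset Printing Implicit Defensive.

Local Open Scope classical_set_scope.

(** * Diagonals, supports and transitive closures *)

Definition diag : pairs := [set p | p.1 = p.2].

(** The least quasiorder on $\{1,\dots,n\}$. Arity 1 means two points, so [discrete 2] is the
    unit. *)
Definition discrete (n : nat) : pairs := [set p | 1 <= p.1 <= n /\ p.1 = p.2].

Definition supported (n : nat) (R : pairs) : Prop :=
  forall x y, R (x, y) -> (1 <= x <= n) /\ (1 <= y <= n).

Lemma supported_tclosure n R : supported n R -> supported n (tclosure R).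
Proof.
move=> sR x y; rewrite /tclosure /=; elim=> {x y} [x y /sR //|].
by move=> x y z _ [? _] _ [_ ?].
Qed.

Lemma tclosure_sub R U : R `<=` U ->
  (forall x y z, U (x, y) -> U (y, z) -> U (x, z)) -> tclosure R `<=` U.
Proof.
move=> sRU tU [x y]; rewrite /tclosure /=.
by elim=> {x y} [x y /sRU //|x y z _ xy _]; apply: tU.
Qed.

Lemma quasiorder_tclosure n R : supported n R -> discrete n `<=` R ->
  quasiorder_on n (tclosure R).
Proof.
move=> sR dR; split.
- exact: supported_tclosure.
- by move=> x xn; apply: sub_tclosure; apply: dR.
- by move=> x y z; apply: t_trans.
Qed.

Lemma quasiorder_tclosure_id n Q : quasiorder_on n Q -> tclosure Q = Q.
Proof.
move=> [_ _ tQ]; apply/seteqP; split; last exact: sub_tclosure.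
exact: tclosure_sub.
Qed.

Lemma quasiorder_supported n Q : quasiorder_on n Q -> supported n Q.
Proof. by case. Qed.

Lemma tclosure_idem R : tclosure (tclosure R) = tclosure R.
Proof.
apply/seteqP; split; last exact: sub_tclosure.
by apply: tclosure_min.
Qed.

(** A shift carries chains to chains, so closing [A] and [B] beforehand adds only pairs that the
    outer closure contains anyway. *)
Lemma tclosure_graft m i A B :
  tclosure (graft m i (tclosure A) (tclosure B)) = tclosure (graft m i A B).
Proof.
apply/seteqP; split; apply: tclosure_min.
  by rewrite subUset; split; apply: tclosure_sigma2;
    [exact: subsetUl | exact: subsetUr].
apply: subset_trans (@sub_tclosure _).
by apply: setUSS; apply: image_subset; exact: sub_tclosure.
Qed.

Lemma tclosure_graftl n m i A B : quasiorder_on n B ->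
  tclosure (graft m i (tclosure A) B) = tclosure (graft m i A B).
Proof. by move=> /quasiorder_tclosure_id eB; rewrite -{1}eB tclosure_graft. Qed.

Lemma tclosure_graftr n m i A B : quasiorder_on n A ->
  tclosure (graft m i A (tclosure B)) = tclosure (graft m i A B).
Proof. by move=> /quasiorder_tclosure_id eA; rewrite -{1}eA tclosure_graft. Qed.

(** * Underlying set of a graft *)

Lemma graft_supported n m i A B : 0 < m -> 1 <= i <= n ->
  supported n.+1 A -> supported m.+1 B -> supported (n + m) (graft m i A B).
Proof.
move=> m0 lein sA sB x y; rewrite /graft /sigma2 => -[] [[a b] ab [<- <-]] /=;
  rewrite /sigma.
- by have [] := sA _ _ ab; case: ifP; case: ifP; lia.
- by have [] := sB _ _ ab; case: ifP; case: ifP; lia.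
Qed.

(** The shifted points of [A] fill $[1,i]$ and $[i+m,n+m]$, those of [B] fill $[i,i+m]$; the two
    sets share exactly [i] and [i + m]. *)
Lemma graft_discrete n m i A B : 0 < m -> 1 <= i <= n ->
  discrete n.+1 `<=` A -> discrete m.+1 `<=` B ->
  discrete (n + m) `<=` graft m i A B.
Proof.
move=> m0 lein dA dB [x _] [/= xnm <-].
have [xi|ix] := leqP x i.
  left; exists (x, x); first by apply: dA; split=> //=; lia.
  by rewrite /sigma2 /sigma /= xi.
have [xim|imx] := leqP x (i + m).
  right; exists (x - i + 1, x - i + 1); first by apply: dB; split=> //=; lia.
  by rewrite /sigma2 /sigma /=; case: ifP => [|_]; [lia | congr pair; lia].
left; exists (x - m + 1, x - m + 1); first by apply: dA; split=> //=; lia.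
by rewrite /sigma2 /sigma /=; case: ifP => [|_]; [lia | congr pair; lia].
Qed.

Lemma quasiorder_discrete n Q : quasiorder_on n Q -> discrete n `<=` Q.
Proof. by move=> [_ rQ _] [x _] [/= xn <-]; apply: rQ. Qed.

Lemma discrete_quasiorder n : quasiorder_on n (discrete n).
Proof.
split=> [x y [/= xn <-] //|x xn //|x y z [/= xn xy] [/= _ yz]].
by split=> //=; rewrite xy.
Qed.

(** * Operad identities for grafts, before closure *)

(** Agreement is asked only on the support, because some identities between shifts fail beyond
    it. *)
Lemma eq_sigma2_image n (R : pairs) (f g : nat * nat -> nat * nat)
    (s t : nat -> nat) :
  (forall p, f p = (s p.1, s p.2)) -> (forall p, g p = (t p.1, t p.2)) ->
  supported n R -> (forall x, 1 <= x <= n -> s x = t x) ->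
  f @` R = g @` R.
Proof.
move=> fE gE sR st; apply: eq_imagel => -[x y] /sR[xn yn].
by rewrite fE gE /= !st.
Qed.

Lemma graft_parallel n1 n2 n3 i j A B C : 0 < n2 -> 1 <= i -> i < j ->
  supported n1 A -> supported n2.+1 B -> supported n3.+1 C ->
  graft n3 (j + n2 - 1) (graft n2 i A B) C =
  graft n2 i (graft n3 j A C) B.
Proof.
move=> n20 i1 ij sA sB sC; rewrite /graft !image_setU !image_comp setUAC.
congr (_ `|` _ `|` _).
- apply: (eq_sigma2_image (s := fun x => sigma (j + n2 - 1) n3 (sigma i n2 x))
    (t := fun x => sigma i n2 (sigma j n3 x))) sA _ => // x xn.
  by rewrite /sigma; repeat case: ifP; lia.
- apply: (eq_sigma2_image (s := sigma 0 (j + n2 - 1))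
    (t := fun x => sigma i n2 (sigma 0 j x))) sC _ => // x xn.
  by rewrite /sigma; repeat case: ifP; lia.
(* Points of [B] land at most at [i + n2], which is at most [j + n2 - 1] since [i < j], so inserting
   [C] leaves them fixed. *)
- apply: (eq_sigma2_image (s := fun x => sigma (j + n2 - 1) n3 (sigma 0 i x))
    (t := sigma 0 i)) sB _ => // x xn.
  by rewrite /sigma; repeat case: ifP; lia.
Qed.

Lemma graft_sequential n1 n2 n3 i j A B C : 0 < n3 -> 1 <= i -> 1 <= j <= n2 ->
  supported n1 A -> supported n2.+1 B -> supported n3.+1 C ->
  graft n3 (i + j - 1) (graft n2 i A B) C =
  graft (n2 + n3 - 1) i A (graft n3 j B C).
Proof.
move=> n30 i1 jn2 sA sB sC; rewrite /graft !image_setU !image_comp setUA.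
congr (_ `|` _ `|` _).
(* A point [x > i] moves to at least [i + n2], beyond [i + j - 1] because [j <= n2]; hence both
   shifts apply to it and add up. *)
- apply: (eq_sigma2_image (s := fun x => sigma (i + j - 1) n3 (sigma i n2 x))
    (t := sigma i (n2 + n3 - 1))) sA _ => // x xn.
  by rewrite /sigma; repeat case: ifP; lia.
- apply: (eq_sigma2_image (s := fun x => sigma (i + j - 1) n3 (sigma 0 i x))
    (t := fun x => sigma 0 i (sigma j n3 x))) sB _ => // x xn.
  by rewrite /sigma; repeat case: ifP; lia.
- apply: (eq_sigma2_image (s := sigma 0 (i + j - 1))
    (t := fun x => sigma 0 i (sigma 0 j x))) sC _ => // x xn.
  by rewrite /sigma; repeat case: ifP; lia.
Qed.

(** The shift [sigma i 1] is the identity, and the unit contributes only the loops at [i] and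
    [i + 1], already in [A]. *)
Lemma graft_unitr n i A : 1 <= i <= n -> discrete n.+1 `<=` A ->
  graft 1 i A (discrete 2) = A.
Proof.
move=> lein dA.
have -> : graft 1 i A (discrete 2) = A `|` sigma2 0 i @` discrete 2.
  congr (_ `|` _); rewrite -[RHS]image_id; apply: eq_imagel => -[x y] _.
  by rewrite /sigma2 /sigma /= !addnK !if_same.
apply/setUidPl => _ [[x _] [/= x2 <-] <-]; apply: dA; split=> //=.
by rewrite /sigma; case: ifP; lia.
Qed.

(** Here [sigma 0 1] is the identity and the unit contributes the loops at the end points 1 and
    [n + 1]. *)
Lemma graft_unitl n A : supported n.+1 A -> discrete n.+1 `<=` A ->
  graft n 1 (discrete 2) A = A.
Proof.
move=> sA dA.
have -> : graft n 1 (discrete 2) A = sigma2 1 n @` discrete 2 `|` A.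
  congr (_ `|` _); rewrite -[RHS]image_id; apply: eq_imagel => -[x y] _.
  by rewrite /sigma2 /sigma /= !addnK !if_same.
apply/setUidPr => _ [[x _] [/= x2 <-] <-]; apply: dA; split=> //=.
by rewrite /sigma; case: ifP; lia.
Qed.

Lemma QOSet_operad : is_operad (QOSet (discrete 2)).
Proof.
split=> /=.
- exact: discrete_quasiorder.
- move=> n m i p q m0 lein qp qq.
  have -> : (n + m - 1).+1 = n + m by lia.
  apply: quasiorder_tclosure.
    by apply: graft_supported => //; exact: quasiorder_supported.
  by apply: graft_discrete => //; exact: quasiorder_discrete.
- move=> n1 n2 n3 i j p1 p2 p3 n20 n30 i1 ij jn1 q1 q2 q3.
  (* Inner closures are absorbed, leaving an equality of plain grafts. *)
  rewrite (tclosure_graftl _ _ _ q3) (tclosure_graftl _ _ _ q2).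
  congr tclosure; apply: graft_parallel => //;
    by apply: quasiorder_supported; eassumption.
- move=> n1 n2 n3 i j p1 p2 p3 n30 /andP[i1 _] jn2 q1 q2 q3.
  rewrite (tclosure_graftl _ _ _ q3) (tclosure_graftr _ _ _ q1).
  congr tclosure; apply: graft_sequential => //;
    by apply: quasiorder_supported; eassumption.
- move=> n i p lein qp; rewrite (graft_unitr lein) ?(quasiorder_tclosure_id qp) //.
  exact: quasiorder_discrete.
- move=> n p _ qp; rewrite graft_unitl ?(quasiorder_tclosure_id qp) //.
    exact: quasiorder_supported.
  exact: quasiorder_discrete.
Qed.

(** * Removing loops, and the isomorphism *)

Lemma tclosureA_setD_diag R : tclosureA (R `\` diag) = tclosureA R.
Proof.
apply/seteqP; split=> -[x y] [Rxy nxy]; split=> //.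
  by move: Rxy; apply: tclosure_sub => [z [Rz _]|]; [exact: sub_tclosure | exact: t_trans].
(* With the diagonal adjoined, the closure of the loop-free part stays transitive and contains
   [R]. *)
suff: (tclosure (R `\` diag) `|` diag) (x, y) by case.
move: Rxy; apply: tclosure_sub => [[u v] Ruv|u v w].
  have [euv|/eqP nuv] := eqVneq u v; first by right.
  by left; apply: sub_tclosure.
case=> [uv|]; last by rewrite /diag /= => ->.
case=> [vw|]; first by left; exact: t_trans uv vw.
by rewrite /diag /= => <-; left.
Qed.

Lemma eq_Sclass R R' : tclosureA R = tclosureA R' -> Sclass R = Sclass R'.
Proof. by rewrite /Sclass => ->. Qed.

Lemma Sclass_inj R R' : Sall R -> Sclass R = Sclass R' ->
  tclosureA R = tclosureA R'.
Proof.
move=> SR e; have : Sclass R R by [].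
by rewrite e => -[_ ->].
Qed.

Lemma tclosureA_tclosure R : tclosureA (tclosure R) = tclosureA R.
Proof. by rewrite /tclosureA tclosure_idem. Qed.

Lemma Sn_setD_diag n R : supported n.+1 R -> Sn n (R `\` diag).
Proof. by move=> sR x y [/sR[xn yn] nxy]. Qed.

(** Shifts send loops to loops, so an off-diagonal pair of the graft can only come from an
    off-diagonal pair. *)
Lemma graft_setD_diag m i A B :
  graft m i (A `\` diag) (B `\` diag) `\` diag = graft m i A B `\` diag.
Proof.
apply/seteqP; split.
  by apply: setSD; apply: setUSS; apply: image_subset; exact: subDsetl.
move=> _ [[] [[x y] Rxy <-]] nxy; split=> //; [left|right]; exists (x, y) => //;
  by split=> // exy; apply: nxy; rewrite /diag /= in exy *; rewrite exy.
Qed.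

(** Recovers a quasiorder from the invariant that defines its class, which gives injectivity. *)
Lemma quasiorder_tclosureAE n Q : quasiorder_on n Q ->
  Q = tclosureA Q `|` discrete n.
Proof.
move=> qQ; rewrite /tclosureA (quasiorder_tclosure_id qQ).
apply/seteqP; split=> [[x y] Qxy|z [[]//|]]; last exact: quasiorder_discrete.
have [exy|/eqP nxy] := eqVneq x y; last by left.
by right; split=> //; have [] := quasiorder_supported qQ Qxy.
Qed.

Lemma QOSet_iso_OP : operad_iso (QOSet (discrete 2)) OP.
Proof.
(* Loops must be deleted first, since members of [Sn] have none. *)
exists (fun _ Q => Sclass (Q `\` diag)); split=> /=.
- move=> n n0; split.
  + move=> Q qQ; exists (Q `\` diag) => //.
    exact: Sn_setD_diag (quasiorder_supported qQ).
  + move=> Q Q'; rewrite !inE /= => qQ qQ' /Sclass_inj.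
    have SQ : Sall (Q `\` diag).
      by exists n => //; exact: Sn_setD_diag (quasiorder_supported qQ).
    move=> /(_ SQ); rewrite !tclosureA_setD_diag => e.
    by rewrite (quasiorder_tclosureAE qQ) e -(quasiorder_tclosureAE qQ').
  + move=> _ [R SR <-]; exists (tclosure (R `|` discrete n.+1)) => /=.
      apply: quasiorder_tclosure; last exact: subsetUr.
      by move=> x y [/SR[]//|[/= xn <-]].
    apply: eq_Sclass; rewrite tclosureA_setD_diag tclosureA_tclosure.
    (* Stripping loops on both sides makes the adjoined [discrete n.+1] disappear. *)
    rewrite -tclosureA_setD_diag -[RHS]tclosureA_setD_diag; congr tclosureA.
    rewrite setDUl [X in _ `|` X](_ : _ = set0) ?setU0 //.
    by apply/seteqP; split=> // z [[_ ez]].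
- apply: eq_Sclass; congr tclosureA.
  by apply/seteqP; split=> // z [[_ ez]].
- move=> n m i p q m0 lein qp qq; have n0 : 0 < n by lia.
  (* The composite of classes is computed on the loop-free representatives. *)
  have := @op_comp_OP n m i (p `\` diag) (q `\` diag) n0 m0
    (Sn_setD_diag (quasiorder_supported qp))
    (Sn_setD_diag (quasiorder_supported qq)).
  move=> /= ->; apply: eq_Sclass.
  rewrite tclosureA_setD_diag tclosureA_tclosure.
  by rewrite -tclosureA_setD_diag -graft_setD_diag tclosureA_setD_diag.
Qed.

Theorem theorem3 :
  exists e : pairs, is_operad (QOSet e) /\ operad_iso (QOSet e) OP.
Proof.
by exists (discrete 2); split; [exact: QOSet_operad | exact: QOSet_iso_OP].
Qed.
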